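(* Let $M$ be an immersed submanifold of a metallic Riemannian manifold $(\overline{M},\overline{g},J)$ with $J^2=pJ+qI$. Then $M$ is a semi-slant submanifold of $\overline{M}$ if and only if there exists a constant $\lambda\in[0,1)$ such that $$D=\{X\in\Gamma(TM)\mid T^2X=\lambda(pTX+qX)\}$$ is a distribution and $NX=0$ for any $X\in\Gamma(TM)$ orthogonal to $D$.
   Context: $p,q$ are positive integers. A metallic Riemannian manifold $(\overline{M},\overline{g},J)$ is a Riemannian manifold with a $(1,1)$-tensor field $J$ such that $J^2=pJ+qI$ and $\overline{g}(JX,Y)=\overline{g}(X,JY)$ for all vector fields $X,Y$. $M$ is an $m'$-dimensional submanifold isometrically immersed in the $m$-dimensional manifold $\overline{M}$, $m>m'\ge1$. For $X\in\Gamma(TM)$, $JX=TX+NX$ is the decomposition into the parts tangent and normal to $M$. A differentiable distribution $D'$ on $M$ is slant with slant angle $\theta$ if the angle between $JX_x$ and $D'_x$ is a constant $\theta$, for all $x\in M$ and nonzero $X_x\in D'_x$; equivalently $\cos\theta=\frac{\|P_{D'}TX\|}{\|JX\|}$ for nonzero $X\in D'$, where $P_{D'}$ is the orthogonal projection onto $D'$. $M$ is a semi-slant submanifold if there exist two orthogonal distributions $D_1,D_2$ on $M$ such that $TM=D_1\oplus D_2$ (orthogonal direct sum), $D_1$ is invariant ($J(D_1)=D_1$), and $D_2$ is slant with angle $\theta\neq0$. *)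

(* Defs.v *)
From mathcomp Require Import all_boot all_order all_algebra.
From mathcomp Require Import all_classical all_reals all_analysis.

Set Implicit Arguments.
Unset Strict Implicit.
Unset Printing Implicit Defensive.

Import Order.TTheory GRing.Theory Num.Theory.
Import numFieldNormedType.Exports.

Local Open Scope classical_set_scope.
Local Open Scope ring_scope.

(* MathComp-Analysis.  Vectors are rows and linear maps act on the right
   ([v *m A]), in agreement with the library's [jacobian]; subspaces are row
   spaces of matrices, compared with [%MS]. *)

Section SmoothFunctions.
Context {R : realType} {V W : normedModType R}.

(* Meant for [U] open. *)
Fixpoint Ck_on (k : nat) (U : set V) (f : V -> W) : Prop :=
  match k with
  | 0 => forall x, U x -> {for x, continuous f}
  | j.+1 => (forall x, U x -> differentiable f x)
            /\ forall v : V, Ck_on j U ('D_v f)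
  end.

Definition smooth_on (U : set V) (f : V -> W) : Prop := forall k, Ck_on k U f.

End SmoothFunctions.

Section Charts.
Context {R : realType} {n : nat} {M : topologicalType}.

(* [chart_fun] and [chart_inv] are total functions, meaningful on [chart_dom]
   and on its image only. *)
Record chart := Chart {
  chart_dom : set M;
  chart_fun :> M -> 'rV[R]_n;
  chart_inv : 'rV[R]_n -> M;
  chart_dom_open : open chart_dom;
  chart_codom_open : open (chart_fun @` chart_dom);
  chart_funK : forall x, chart_dom x -> chart_inv (chart_fun x) = x;
  chart_fun_cont : forall x, chart_dom x -> {for x, continuous chart_fun};
  chart_inv_cont :
    forall x, chart_dom x -> {for chart_fun x, continuous chart_inv} }.

(* Maps the components of a tangent vector at [x] in the chart [phi] to its
   components in the chart [psi]. *)
Definition transition_mx (phi psi : chart) (x : M) : 'M[R]_n :=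
  jacobian (psi \o chart_inv phi) (phi x).

End Charts.
Arguments chart R n M : clear implicits.

(* C^oo, Hausdorff, second countable.  The tangent space at [x] is 'rV[R]_n:
   a tangent vector at [x] is given by its components in the chart
   [chart_at x], which only serves to fix this identification. *)
Record smooth_manifold (R : realType) (n : nat) := SmoothManifold {
  carrier :> topologicalType;
  carrier_hausdorff : hausdorff_space carrier;
  carrier_second_countable : exists B : set (set carrier),
    [/\ countable B, B `<=` open &
        forall (x : carrier) (U : set carrier), open U -> U x ->
          exists V, [/\ B V, V x & V `<=` U]];
  atlas : set (chart R n carrier);
  atlas_compat : forall phi psi, atlas phi -> atlas psi ->
    smooth_on (phi @` (chart_dom phi `&` chart_dom psi))
              (psi \o chart_inv phi);
  chart_at : carrier -> chart R n carrier;
  chart_at_atlas : forall x, atlas (chart_at x);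
  chart_at_dom : forall x, chart_dom (chart_at x) x }.

Section Tensors.
Context {R : realType} {n : nat} {M : smooth_manifold R n}.
Implicit Types (phi : chart R n M) (x : M).

(* Components, in the chart [phi], of tangent vectors at [x]. *)
Definition coord_mx phi x : 'M[R]_n := transition_mx (chart_at x) phi x.

(* The rows are the coordinate vectors of the chart [phi] at [x]. *)
Definition frame_mx phi x : 'M[R]_n := transition_mx phi (chart_at x) x.

Definition smooth_field_on (U : set M) (X : M -> 'rV[R]_n) : Prop :=
  forall phi, atlas phi ->
    smooth_on (phi @` (chart_dom phi `&` U))
      (fun u => let x := chart_inv phi u in X x *m coord_mx phi x).

Definition smooth_field (X : M -> 'rV[R]_n) : Prop := smooth_field_on setT X.

(* (1,1)-tensor fields, i.e. fields of endomorphisms [v |-> v *m J x]. *)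
Definition smooth_endo_field (J : M -> 'M[R]_n) : Prop :=
  forall phi, atlas phi ->
    smooth_on (phi @` chart_dom phi)
      (fun u => let x := chart_inv phi u in
                frame_mx phi x *m J x *m coord_mx phi x).

(* (0,2)-tensor fields. *)
Definition smooth_form_field (g : M -> 'M[R]_n) : Prop :=
  forall phi, atlas phi ->
    smooth_on (phi @` chart_dom phi)
      (fun u => let x := chart_inv phi u in
                frame_mx phi x *m g x *m (frame_mx phi x)^T).

(* A differentiable distribution: the row space of [D x] is the subspace of
   the tangent space at [x]. The rank is constant, and may be 0 or [n]. *)
Definition distribution (D : M -> 'M[R]_n) : Prop :=
  exists k : nat, (forall x, \rank (D x) = k) /\
    forall x, exists U : set M, [/\ open U, U x &
      exists X : 'I_k -> M -> 'rV[R]_n,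
        (forall i, smooth_field_on U (X i)) /\
        (forall y, U y -> (D y == \matrix_(i < k) X i y)%MS)].

Definition sections (D : M -> 'M[R]_n) : set (M -> 'rV[R]_n) :=
  [set X | smooth_field X /\ forall x, (X x <= D x)%MS].

Definition is_distribution (S : set (M -> 'rV[R]_n)) : Prop :=
  exists D : M -> 'M[R]_n, distribution D /\ S = sections D.

End Tensors.

Section InnerProduct.
Context {R : realType} {n : nat}.
Implicit Types (G : 'M[R]_n) (u v w : 'rV[R]_n).

Definition inner G u v : R := (u *m G *m v^T) 0 0.

Definition gnorm G u : R := Num.sqrt (inner G u u).

(* The vectors [u] such that [inner G u w = 0] for all [w] in [W]. *)
Definition orth_compl G {k : nat} (W : 'M[R]_(k, n)) : 'M[R]_n :=
  kermx (G *m W^T).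

Definition orth_proj G {k : nat} (W : 'M[R]_(k, n)) : 'M[R]_n :=
  proj_mx <<W>>%MS (orth_compl G W).

(* The angle, in [0, pi/2], between a nonzero vector and a subspace. *)
Definition angle G w {k : nat} (W : 'M[R]_(k, n)) : R :=
  acos (gnorm G (w *m orth_proj G W) / gnorm G w).

End InnerProduct.

Record riemannian_manifold (R : realType) (n : nat) := RiemannianManifold {
  riem_manifold :> smooth_manifold R n;
  metric : riem_manifold -> 'M[R]_n;
  metric_sym : forall x u v, inner (metric x) u v = inner (metric x) v u;
  metric_posdef : forall x u, u != 0 -> 0 < inner (metric x) u u;
  metric_smooth : smooth_form_field metric }.

Definition metallic_structure {R : realType} {n : nat} (p q : nat)
    (M : riemannian_manifold R n) (J : M -> 'M[R]_n) : Prop :=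
  [/\ smooth_endo_field J,
      forall x (u : 'rV[R]_n),
        u *m J x *m J x = p%:R *: (u *m J x) + q%:R *: u &
      forall x (u v : 'rV[R]_n),
        inner (metric x) (u *m J x) v = inner (metric x) u (v *m J x)].

Section Maps.
Context {R : realType} {n' n : nat}.
Variables (M : smooth_manifold R n') (Mbar : smooth_manifold R n).

Definition smooth_map (f : M -> Mbar) : Prop :=
  continuous f /\
  forall phi psi, atlas phi -> atlas psi ->
    smooth_on (phi @` (chart_dom phi `&` f @^-1` chart_dom psi))
              (psi \o f \o chart_inv phi).

Definition differential (f : M -> Mbar) (x : M) : 'M[R]_(n', n) :=
  jacobian (chart_at (f x) \o f \o chart_inv (chart_at x)) (chart_at x x).

End Maps.

Section Submanifold.
Context {R : realType} {n' n : nat}.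
Context {M : riemannian_manifold R n'} {Mbar : riemannian_manifold R n}.
Variables (f : M -> Mbar) (J : Mbar -> 'M[R]_n).
Implicit Types (D : M -> 'M[R]_n') (x : M).

(* Immersed submanifold with the induced metric; [f] need not be injective. *)
Definition isometric_immersion : Prop :=
  [/\ smooth_map f,
      forall x, row_free (differential f x) &
      forall x u v, inner (metric x) u v =
        inner (metric (f x)) (u *m differential f x) (v *m differential f x)].

(* [J X = T X + N X]. Tangent vectors [u] of [M] are identified with
   [u *m differential f x]; [tan_part] takes values in the tangent space of [M]
   (whence the [pinvmx]), [nor_part] in that of [Mbar]. *)
Definition tan_part x : 'M[R]_n' :=
  let F := differential f x in
  F *m J (f x) *m proj_mx <<F>>%MS (orth_compl (metric (f x)) F) *m pinvmx F.

Definition nor_part x : 'M[R]_(n', n) :=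
  let F := differential f x in
  F *m J (f x) *m proj_mx (orth_compl (metric (f x)) F) <<F>>%MS.

Definition slant D (theta : R) : Prop :=
  forall x (u : 'rV[R]_n'), (u <= D x)%MS -> u != 0 ->
    angle (metric (f x)) (u *m differential f x *m J (f x))
          (D x *m differential f x) = theta.

Definition invariant_distribution D : Prop :=
  forall x, (D x *m differential f x *m J (f x) == D x *m differential f x)%MS.

Definition semi_slant : Prop :=
  exists D1 D2 : M -> 'M[R]_n',
    [/\ distribution D1 /\ distribution D2,
        forall x (u v : 'rV[R]_n'), (u <= D1 x)%MS -> (v <= D2 x)%MS ->
          inner (metric x) u v = 0,
        forall x, (D1 x + D2 x == 1%:M)%MS,
        invariant_distribution D1 &
        exists theta : R, theta != 0 /\ slant D2 theta].

Definition eigen_fields (p q : nat) (lambda : R) : set (M -> 'rV[R]_n') :=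
  [set X | smooth_field X /\
     forall x, X x *m tan_part x *m tan_part x =
       lambda *: (p%:R *: (X x *m tan_part x) + q%:R *: X x)].

End Submanifold.

(* Main.v *)
From HB Require Import structures.
Require Import Defs.
From mathcomp Require Import all_boot all_order all_algebra.
From mathcomp Require Import all_classical all_reals all_analysis.
From mathcomp Require Import ring lra.
Import Order.TTheory GRing.Theory Num.Theory.
Import numFieldNormedType.Exports.
Local Open Scope ring_scope.

Set Implicit Arguments.
Unset Strict Implicit.
Unset Printing Implicit Defensive.

(** Write [T] and [N] for the tangential and normal parts of [J] along [M].

    At one point, [J] self-adjoint and [J ^+ 2 = p J + q] imply that [T] is
    self-adjoint and that [|J u| ^+ 2 = <(p T + q) u, u>] for [u] tangent.
    On a [T]-stable subspace [D], the projection of [J u] onto [D] is [T u],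
    so having a constant angle means [|T u| ^+ 2 = lam |J u| ^+ 2] with
    [lam = cos theta ^+ 2].  By polarization ([tan_eigen_of_norm]) this is the
    linear equation [T (T u) = lam (p T u + q u)].  A solution with [N u = 0]
    has [|T u| = |J u|], and so vanishes when [lam < 1] ([tan_eigen_nor0]).

    If [M] is semi-slant, the second summand consists of solutions and the
    first one meets them trivially, as [N] is zero on it.  Hence the solutions
    are exactly the sections of the second summand ([semi_slant_eigen]).
    Conversely, let [D] be the distribution of solutions, with [N = 0] on its
    orthogonal complement.  No other vector solves the equation, hence [D] and
    its complement are [T]-stable; [J] is [T] on the complement, which is
    therefore invariant, and [D] is slant ([eigen_semi_slant]).

    The algebra is pointwise, whereas the statement speaks of global smooth
    fields.  Two facts fill the gap.  Every vector of a distribution is the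
    value of a global section ([sections_at]): multiply a local section by a
    bump function.  The orthogonal complement of a distribution is a
    distribution ([orth_distribution]): a local frame is obtained from the
    adjugate of a Gram matrix.  Both are read in charts, and rest on a small
    calculus of functions of class C^k. *)

(** * Calculus of C^k functions *)

Section SmoothCalculus.
Local Open Scope classical_set_scope.
Context {R : realType} {V : normedModType R}.

Lemma near_eq_differentiable (W : normedModType R) (f g : V -> W) (x : V) :
  (\near x, f x = g x) -> differentiable f x -> differentiable g x.
Proof.
move=> fg [[dfc dfx]]; apply/diffP.
apply: (@getPex _ (fun (df : {linear V -> W}) => continuous df /\
  forall y, g y = g (lim (nbhs x)) + df (y - lim (nbhs x))
                  +o_(y \near x) (y - lim (nbhs x)))).
exists ('d f x); split=> //.
suff : g = cst (g (lim (nbhs x))) + 'd f x \o center (lim (nbhs x))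
    +o_x (center (lim (nbhs x))) by rewrite {1}funeqE.
move: dfx; rewrite lim_id //.
move=> /eqaddoP dfx; apply/eqaddoP => e e0; have := dfx e e0.
have fgx := nbhs_singleton fg.
by move=> fe; near=> y; rewrite !fctE -fgx -(near fg y)//; near: y.
Unshelve. all: by end_near. Qed.

(** Differentiability conditions are imposed pointwise, so a set can be shrunk,
    or replaced by one set for each of its points. *)
Lemma Ck_on_sub (W : normedModType R) k (U U' : set V) (f : V -> W) :
  U' `<=` U -> Ck_on k U f -> Ck_on k U' f.
Proof.
elim: k f => [|k IH] f UU' /=; first by move=> cf x /UU'; apply: cf.
by move=> [df Df]; split=> [x /UU' /df|v] //; apply: IH.
Qed.

Lemma Ck_on_local (W : normedModType R) k (U : set V) (f : V -> W) :
  (forall x, U x -> exists2 O, O x & Ck_on k O f) -> Ck_on k U f.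
Proof.
elim: k f => [|k IH] f fU /=; first by move=> x /fU[A Ax]; apply.
split=> [x /fU[A Ax []]|v]; first by move=> + _; apply.
by apply: IH => x /fU[A Ax [_ /(_ v)]]; exists A.
Qed.

(** Openness cannot be dropped: derivatives at a point see a neighbourhood. *)
Lemma Ck_on_eq (W : normedModType R) k (U : set V) (f g : V -> W) :
  open U -> (forall x, U x -> f x = g x) -> Ck_on k U f -> Ck_on k U g.
Proof.
move=> oU; elim: k f g => [|k IH] f g fg /=.
  move=> cf x Ux; have fgx : \forall y \near x, f y = g y.
    by apply: filterS (open_nbhs_nbhs (conj oU Ux)) => y /fg.
  have : f z @[z --> x] --> g x by rewrite -fg //; exact: cf.
  by apply: cvg_trans; apply: near_eq_cvg.
have near_fg x : U x -> \forall y \near x, f y = g y.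
  by move=> Ux; apply: filterS (open_nbhs_nbhs (conj oU Ux)) => y /fg.
move=> [df Df]; split=> [x Ux|v].
  exact: near_eq_differentiable (near_fg x Ux) (df x Ux).
by apply: IH (Df v) => x Ux; apply: near_eq_derive; apply: near_fg.
Qed.

Lemma Ck_onW (W : normedModType R) k (U : set V) (f : V -> W) :
  Ck_on k.+1 U f -> Ck_on k U f.
Proof.
elim: k f => [|k IH] f [df Df] /=.
  by move=> x Ux; apply/differentiable_continuous/df.
by split=> // v; apply/IH/Df.
Qed.

Lemma Ck_on_cst (W : normedModType R) k (U : set V) (w : W) :
  Ck_on k U (cst w).
Proof.
elim: k w => [|k IH] w /=; first by move=> x _; apply: cvg_cst.
split=> // v; rewrite (_ : 'D_v _ = cst 0); first exact: IH.
by apply/funext => x; rewrite derive_cst.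
Qed.

(** Any continuous linear map commutes with directional derivatives. *)
Lemma Ck_on_lin (W W' : normedModType R) k (U : set V) (f : V -> W)
    (L : {linear W -> W'}) : continuous L -> open U ->
  Ck_on k U f -> Ck_on k U (L \o f).
Proof.
move=> cL oU; elim: k f => [|k IH] f /=.
  by move=> cf x Ux; apply: continuous_comp; [apply: cf|apply: cL].
move=> [df Df]; split=> [x Ux|v].
  apply: differentiable_comp; first exact: df.
  exact: linear_differentiable.
apply: Ck_on_eq (IH _ (Df v)) => // x Ux.
have dL : differentiable L (f x) by apply: linear_differentiable.
have dfx := df x Ux; have dLf := differentiable_comp dfx dL.
by rewrite [RHS]deriveE // diff_comp // diff_lin //= deriveE.
Qed.

Lemma Ck_onD (W : normedModType R) k (U : set V) (f g : V -> W) :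
  open U -> Ck_on k U f -> Ck_on k U g -> Ck_on k U (fun x => f x + g x).
Proof.
move=> oU; elim: k f g => [|k IH] f g /=.
  by move=> cf cg x Ux; apply: cvgD; [apply: cf|apply: cg].
move=> [df Df] [dg Dg]; split=> [x Ux|v].
  by apply: differentiableD; [apply: df|apply: dg].
apply: Ck_on_eq (IH _ _ (Df v) (Dg v)) => // x Ux.
by rewrite -deriveD //; apply: diff_derivable; [apply: df|apply: dg].
Qed.

Lemma Ck_on_sum (W : normedModType R) k (U : set V) I (r : seq I) (P : pred I)
    (F : I -> V -> W) : open U -> (forall i, P i -> Ck_on k U (F i)) ->
  Ck_on k U (fun x => \sum_(i <- r | P i) F i x).
Proof.
move=> oU FU; elim: r => [|i r IH].
  rewrite (_ : (fun _ => _) = cst 0); first exact: Ck_on_cst.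
  by apply/funext => x; rewrite big_nil.
case Pi : (P i); last first.
  by apply: Ck_on_eq IH => // x _; rewrite big_cons Pi.
apply: (Ck_on_eq oU _ (Ck_onD oU (FU _ Pi) IH)) => x _.
by rewrite big_cons Pi.
Qed.

Lemma Ck_onM k (U : set V) (f g : V -> R) :
  open U -> Ck_on k U f -> Ck_on k U g -> Ck_on k U (fun x => f x * g x).
Proof.
move=> oU; elim: k f g => [|k IH] f g.
  by move=> cf cg x Ux; apply: cvgM; [apply: cf|apply: cg].
move=> fU gU; have [f_U g_U] := (Ck_onW fU, Ck_onW gU).
case: fU gU => [df Df] [dg Dg]; split=> [x Ux|v].
  by apply: differentiableM; [apply: df|apply: dg].
have := Ck_onD oU (IH _ _ f_U (Dg v)) (IH _ _ g_U (Df v)).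
apply: Ck_on_eq => // x Ux.
rewrite deriveM //; apply: diff_derivable; [exact: df|exact: dg].
Qed.

Lemma Ck_on_prod k (U : set V) I (r : seq I) (P : pred I)
    (F : I -> V -> R) : open U -> (forall i, P i -> Ck_on k U (F i)) ->
  Ck_on k U (fun x => \prod_(i <- r | P i) F i x).
Proof.
move=> oU FU; elim: r => [|i r IH].
  rewrite (_ : (fun _ => _) = cst 1); first exact: Ck_on_cst.
  by apply/funext => x; rewrite big_nil.
case Pi : (P i); last first.
  by apply: Ck_on_eq IH => // x _; rewrite big_cons Pi.
apply: (Ck_on_eq oU _ (Ck_onM oU (FU _ Pi) IH)) => x _.
by rewrite big_cons Pi.
Qed.

(** The derivative of the inverse is polynomial in the inverse itself, which
    makes the induction on the order of differentiability close. *)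
Lemma Ck_onV k (U : set V) (f : V -> R) : open U ->
  (forall x, U x -> f x != 0) -> Ck_on k U f -> Ck_on k U (fun x => (f x)^-1).
Proof.
move=> oU f0; elim: k => [|k IH].
  by move=> cf x Ux; apply: cvgV; [apply: f0|apply: cf].
move=> fU; have Vf := IH (Ck_onW fU).
case: fU => [df Df]; split=> [x Ux|v].
  by apply: differentiableV; [apply: df|apply: f0].
have := Ck_onM oU (Ck_on_cst k U (-1 : R)) (Ck_onM oU (Ck_onM oU Vf Vf) (Df v)).
apply: Ck_on_eq => // x Ux.
rewrite deriveV; [|exact: f0|by apply: diff_derivable; apply: df].
by rewrite /cst mulN1r -exprVn expr2 scaleNr.
Qed.

Lemma Ck_on_coord k m n (U : set V) (f : V -> 'M[R]_(m, n)) i j : open U ->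
  Ck_on k U f -> Ck_on k U (fun x => f x i j).
Proof.
move=> oU; pose L (A : 'M[R]_(m, n)) := A i j.
have L_lin : linear L by move=> a u v; rewrite /L !mxE.
pose sL := GRing.isLinear.Build _ _ _ _ _ L_lin.
pose LL : {linear _ -> _} := HB.pack L sL.
by apply: (@Ck_on_lin _ _ k U f LL) => //; apply: coord_continuous.
Qed.

(** A matrix function is the sum of its entries times constant matrices, which
    reduces smoothness to the scalar case. *)
Lemma Ck_on_mx k m n (U : set V) (f : V -> 'M[R]_(m, n)) : open U ->
  (forall i j, Ck_on k U (fun x => f x i j)) -> Ck_on k U f.
Proof.
move=> oU fU.
have : Ck_on k U (fun x => \sum_i \sum_j f x i j *: delta_mx i j).
  apply: Ck_on_sum => // i _; apply: Ck_on_sum => // j _.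
  pose L (a : R) : 'M[R]_(m, n) := a *: delta_mx i j.
  have L_lin : linear L by move=> a u v; rewrite /L scalerDl scalerA.
  pose sL := GRing.isLinear.Build _ _ _ _ _ L_lin.
  pose LL : {linear _ -> _} := HB.pack L sL.
  apply: (@Ck_on_lin _ _ k U (fun x => f x i j) LL) => //.
  exact: scalel_continuous.
by apply: Ck_on_eq => // x _; rewrite -matrix_sum_delta.
Qed.

Lemma Ck_on_mulmx k m n l (U : set V) (f : V -> 'M[R]_(m, n))
    (g : V -> 'M[R]_(n, l)) : open U ->
  Ck_on k U f -> Ck_on k U g -> Ck_on k U (fun x => f x *m g x).
Proof.
move=> oU fU gU; apply: Ck_on_mx => // i j.
have : Ck_on k U (fun x => \sum_h f x i h * g x h j).
  by apply: Ck_on_sum => // h _; apply: Ck_onM => //; apply: Ck_on_coord.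
by apply: Ck_on_eq => // x _; rewrite mxE.
Qed.

Lemma Ck_on_scale k m n (U : set V) (a : V -> R) (f : V -> 'M[R]_(m, n)) :
  open U -> Ck_on k U a -> Ck_on k U f -> Ck_on k U (fun x => a x *: f x).
Proof.
move=> oU aU fU; apply: Ck_on_mx => // i j.
apply: (Ck_on_eq oU _ (Ck_onM oU aU (Ck_on_coord i j oU fU))) => x _.
by rewrite mxE.
Qed.

Lemma Ck_on_tr k m n (U : set V) (f : V -> 'M[R]_(m, n)) : open U ->
  Ck_on k U f -> Ck_on k U (fun x => (f x)^T).
Proof.
move=> oU fU; apply: Ck_on_mx => // i j.
by apply: (Ck_on_eq oU _ (Ck_on_coord j i oU fU)) => x _; rewrite mxE.
Qed.

Lemma Ck_on_det k n (U : set V) (f : V -> 'M[R]_n) : open U ->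
  Ck_on k U f -> Ck_on k U (fun x => \det (f x)).
Proof.
move=> oU fU; apply: Ck_on_sum => // s _; apply: Ck_onM => //.
  exact: Ck_on_cst.
by apply: Ck_on_prod => // i _; apply: Ck_on_coord.
Qed.

Lemma Ck_on_adj k n (U : set V) (f : V -> 'M[R]_n) : open U ->
  Ck_on k U f -> Ck_on k U (fun x => \adj (f x)).
Proof.
move=> oU fU; apply: Ck_on_mx => // i j.
have : Ck_on k U (fun x => (-1) ^+ (j + i) * \det (row' j (col' i (f x)))).
  apply: Ck_onM => //; first exact: Ck_on_cst.
  apply: Ck_on_det => //; apply: Ck_on_mx => // a b.
  apply: (Ck_on_eq oU _ (Ck_on_coord (lift j a) (lift i b) oU fU)) => x _.
  by rewrite !mxE.
by apply: Ck_on_eq => // x _; rewrite mxE.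
Qed.

Lemma Ck_on_invmx k n (U : set V) (f : V -> 'M[R]_n) : open U ->
  (forall x, U x -> f x \in unitmx) ->
  Ck_on k U f -> Ck_on k U (fun x => invmx (f x)).
Proof.
move=> oU uf fU.
have : Ck_on k U (fun x => (\det (f x))^-1 *: \adj (f x)).
  apply: Ck_on_scale => //; last exact: Ck_on_adj.
  apply: Ck_onV => //; last exact: Ck_on_det.
  by move=> x /uf; rewrite unitmxE unitfE.
by apply: Ck_on_eq => // x /uf uf_x; rewrite /invmx uf_x.
Qed.

End SmoothCalculus.

(** * A smooth function that is flat at the origin *)

Section Flat.
Local Open Scope classical_set_scope.
Context {R : realType}.

(** The functions [t^-m * exp (-1/t)], extended by zero.  The classical smooth
    but non-analytic function is the case [m = 0]; the whole family is needed
    because it is stable under differentiation. *)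
Definition flat (m : nat) (t : R) : R :=
  if 0 < t then t^-1 ^+ m * expR (- t^-1) else 0.

Lemma flat_ge0 m t : 0 <= flat m t.
Proof.
rewrite /flat; case: ifP => // t0.
by rewrite mulr_ge0 ?expR_ge0 // exprn_ge0 // invr_ge0 ltW.
Qed.

Lemma flat_gt0 m t : (0 < flat m t) = (0 < t).
Proof.
rewrite /flat; case: ifP => [t0|]; last by rewrite ltxx.
by rewrite mulr_gt0 ?expR_gt0 // exprn_gt0 // invr_gt0.
Qed.

(** One term of the exponential series, [expR s >= s ^+ m.+2 / m.+2`!] at
    [s = t^-1], gives a quadratic bound, so that the derivative at 0 is 0. *)
Lemma flat_le m t : flat m t <= (m.+2)`!%:R * t ^+ 2.
Proof.
rewrite /flat; case: ifP => [t0|_]; last first.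
  by rewrite mulr_ge0 ?ler0n // sqr_ge0.
have s0 : 0 < t^-1 by rewrite invr_gt0.
have := expR_ge1Dxn m.+1 (ltW s0); set F := (m.+2)`!%:R => le_exp.
have F0 : 0 < F by rewrite ltr0n fact_gt0.
have {le_exp} : t^-1 ^+ m.+2 <= F * expR t^-1.
  rewrite -ler_pdivrMl // mulrC.
  by apply: le_trans le_exp; rewrite lerDr.
rewrite expRN ler_pdivrMr ?expR_gt0 // => le_exp.
have -> : t^-1 ^+ m = t ^+ 2 * t^-1 ^+ m.+2.
  by rewrite -(addn2 m) exprD mulrCA -exprMn mulfV ?gt_eqF // expr1n mulr1.
by rewrite (mulrAC F) [leRHS]mulrC ler_wpM2l ?sqr_ge0.
Qed.

Lemma is_derive_flat m (t : R) :
  is_derive t 1 (flat m) (flat m.+2 t - m%:R * flat m.+1 t).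
Proof.
have [t0|t0|->] := ltrgtP t 0.
- rewrite {2 3}/flat ltNge (ltW t0) /= mulr0 subr0.
  apply: (near_eq_is_derive _ (is_derive_cst 0 t 1)).
  near=> s; rewrite /flat ltNge ltW //=.
  by near: s; apply: lt_nbhsl.
- pose i (s : R) := s^-1; pose h := i ^+ m * (expR \o (- i)).
  apply: (@near_eq_is_derive _ _ _ h).
    near=> s; rewrite /flat ifT; first by rewrite /h !fctE.
    by near: s; exact: lt_nbhsr.
  have di : is_derive t 1 i (- t ^- 2).
    have := @is_deriveV _ id t 1 1 (lt0r_neq0 t0) (is_derive_id t (1 : R)).
    by rewrite [_ *: _]mulr1.
  have de := is_derive1_comp (is_derive_expR ((- i) t)) (is_deriveN di).
  apply: (is_derive_eq (is_deriveM (is_deriveX m di) de)).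
  rewrite /flat t0 /= /i !fctE opprK /GRing.scale /= -exprVn.
  case: m {h} => [|m] /=.
    by rewrite !mul0r mulr0 subr0 addr0 !expr0; ring.
  by rewrite !exprS; ring.
- rewrite /flat ltxx mulr0 subr0.
  pose d h : R := h^-1 *: ((flat m \o shift 0) (h *: 1) - flat m 0).
  suff d0 : d h @[h --> 0^'] --> (0 : R).
    by constructor; [apply/cvg_ex; exists 0|apply: cvg_lim].
  apply/cvgr0Pnorm_le => e e0; have F0 : 0 < (m.+2)`!%:R :> R.
    by rewrite ltr0n fact_gt0.
  near=> h; have h0 : h != 0 by near: h; exact: nbhs_dnbhs_neq.
  rewrite /d [X in _ - X]/flat ltxx subr0 /= [h *: 1]mulr1 addr0.
  rewrite normrM normfV ler_pdivrMl ?normr_gt0 // (ger0_norm (flat_ge0 _ _)).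
  apply: le_trans (flat_le _ _) _.
  rewrite -real_normK ?num_real // expr2 mulrCA ler_wpM2l //.
  rewrite -ler_pdivlMl // mulrC; near: h; apply: dnbhs0_le.
  by rewrite divr_gt0.
Unshelve. all: by end_near. Qed.

(** Differentiating [flat m \o g] brings in [flat m.+1 \o g] and
    [flat m.+2 \o g], so the induction on [k] must keep [m] general. *)
Lemma Ck_on_flat (V : normedModType R) k m (U : set V) (g : V -> R) : open U ->
  Ck_on k U g -> Ck_on k U (fun x => flat m (g x)).
Proof.
move=> oU; have dflat j t : differentiable (flat j) t.
  by apply/derivable1_diffP; have [] := is_derive_flat j t.
elim: k m => [|k IH] m.
  move=> cg x Ux; apply: continuous_comp; first exact: cg.
  exact/differentiable_continuous/dflat.
move=> gU; have g_U := Ck_onW gU; case: gU => dg Dg; split=> [x Ux|v].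
  by apply: differentiable_comp; [apply: dg|apply: dflat].
have cU := Ck_on_cst k U (- m%:R : R).
have := Ck_onM oU (Ck_onD oU (IH m.+2 g_U) (Ck_onM oU cU (IH m.+1 g_U))) (Dg v).
apply: Ck_on_eq => // x Ux; rewrite /cst mulNr.
have dgx := dg x Ux; have dfg := differentiable_comp dgx (dflat m (g x)).
have /derivable1_diffP/deriv1E dE := dflat m (g x).
rewrite [RHS]deriveE // diff_comp //= dE derive1E -deriveE //.
by rewrite (@derive_val _ _ _ _ _ _ _ (is_derive_flat m (g x))) mulrC.
Qed.

End Flat.

(** * Fields and functions in charts *)

Section ChartTopology.
Local Open Scope classical_set_scope.
Context {R : realType} {n : nat} {M : topologicalType}.

(** All smoothness conditions on the manifold are read on such images, and the
    calculus lemmas need them to be open. *)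
Lemma open_chart_image (phi : chart R n M) (U : set M) :
  open U -> open (phi @` (chart_dom phi `&` U)).
Proof.
move=> oU; rewrite openE => _ [x [dx Ux] <-]; rewrite /interior.
have near_dom : \forall v \near phi x, (phi @` chart_dom phi) v.
  apply: open_nbhs_nbhs; split; first exact: chart_codom_open.
  by exists x.
have near_U : \forall v \near phi x, U (chart_inv phi v).
  apply: (chart_inv_cont dx); rewrite /= chart_funK //.
  exact: open_nbhs_nbhs.
near=> v; have [//|y dy yv] := near near_dom v; exists y; rewrite ?yv//.
by split=> //; rewrite -(chart_funK dy) yv; near: v.
Unshelve. all: by end_near. Qed.

End ChartTopology.

(** The chain rule in the form that transition maps require: their cocycle
    identity only holds near the point. *)
Lemma near_diff_comp (R : realType) (U V W : normedModType R)
    (f : U -> V) (g : V -> W) (h : U -> W) (x : U) (y : V) (v : U) :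
  f x = y -> differentiable f x -> differentiable g y ->
  (\near x, (g \o f) x = h x)%classic -> 'd g y ('d f x v) = 'd h x v.
Proof.
move=> <- df dg gfh; have dgf := differentiable_comp df dg.
have dh := near_eq_differentiable gfh dgf.
rewrite -[RHS]deriveE // -(near_eq_derive _ gfh) [RHS]deriveE //.
by rewrite [in RHS]diff_comp.
Qed.

Section ManifoldCalculus.
Local Open Scope classical_set_scope.
Context {R : realType} {n : nat} {M : smooth_manifold R n}.
Implicit Types (phi psi : chart R n M) (U : set M) (X Y : M -> 'rV[R]_n).

Definition smooth_fun_on U (r : M -> R) : Prop :=
  forall phi, atlas phi ->
    smooth_on (phi @` (chart_dom phi `&` U)) (r \o chart_inv phi).

Lemma transition_mxE phi psi x (v : 'rV[R]_n) :
  v *m transition_mx phi psi x = 'd (psi \o chart_inv phi) (phi x) v.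
Proof. by rewrite /transition_mx /jacobian mul_rV_lin1. Qed.

Lemma transition_differentiable phi psi x : atlas phi -> atlas psi ->
  chart_dom phi x -> chart_dom psi x ->
  differentiable (psi \o chart_inv phi) (phi x).
Proof.
move=> aphi apsi ? ?; have [d _] := atlas_compat aphi apsi 1.
by apply: d; exists x.
Qed.

Lemma near_chart_dom phi psi x : chart_dom phi x -> chart_dom psi x ->
  \forall u \near phi x, exists y,
    [/\ chart_dom phi y, chart_dom psi y & phi y = u].
Proof.
move=> dphi dpsi.
have : open_nbhs (phi x) (phi @` (chart_dom phi `&` chart_dom psi)).
  split; last by exists x.
  by apply: open_chart_image; exact: chart_dom_open.
by move=> /open_nbhs_nbhs; apply: filterS => _ [y [? ?] <-]; exists y.
Qed.

Lemma transition_mx_id phi x : chart_dom phi x -> transition_mx phi phi x = 1%:M.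
Proof.
move=> dx; apply/row_matrixP => i; rewrite !rowE transition_mxE mulmx1.
have near_id : \forall u \near phi x, u = (phi \o chart_inv phi) u.
  near=> u; have [//|y [dy _ <-]] := near (near_chart_dom dx dx) u.
  by rewrite /= chart_funK.
have did : differentiable (phi \o chart_inv phi) (phi x).
  exact: near_eq_differentiable near_id _.
by rewrite -deriveE // -(near_eq_derive _ near_id) derive_id.
Unshelve. all: by end_near. Qed.

Lemma transition_mxM phi psi chi x : atlas phi -> atlas psi -> atlas chi ->
  chart_dom phi x -> chart_dom psi x -> chart_dom chi x ->
  transition_mx phi psi x *m transition_mx psi chi x = transition_mx phi chi x.
Proof.
move=> aphi apsi achi dphi dpsi dchi; apply/row_matrixP => i.
rewrite 2!rowE mulmxA [RHS]transition_mxE [X in X *m _]transition_mxE.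
rewrite [LHS]transition_mxE.
have d1 := transition_differentiable aphi apsi dphi dpsi.
have d2 := transition_differentiable apsi achi dpsi dchi.
apply: near_diff_comp => //; first by rewrite /= chart_funK.
near=> u; have [//|y [dy dy' <-]] := near (near_chart_dom dphi dpsi) u.
by rewrite /= !chart_funK.
Unshelve. all: by end_near. Qed.

Lemma coord_frame_mx phi x : atlas phi -> chart_dom phi x ->
  coord_mx phi x *m frame_mx phi x = 1%:M.
Proof.
move=> aphi dx; have [a d] := (chart_at_atlas x, chart_at_dom x).
by rewrite /coord_mx /frame_mx transition_mxM // transition_mx_id.
Qed.

Lemma smooth_field_on_sub U U' X :
  U' `<=` U -> smooth_field_on U X -> smooth_field_on U' X.
Proof.
move=> UU' XU phi aphi k; apply: Ck_on_sub (XU phi aphi k).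
by apply: image_subset; apply: setIS.
Qed.

Lemma smooth_field_on_local U X :
  (forall x, U x -> exists2 A, A x & smooth_field_on A X) ->
  smooth_field_on U X.
Proof.
move=> XU phi aphi k; apply: Ck_on_local => _ [x [dx /XU[A Ax XA]] <-].
by exists (phi @` (chart_dom phi `&` A)); [exists x|apply: XA].
Qed.

Lemma smooth_field_on_eq U X Y : open U -> (forall x, U x -> X x = Y x) ->
  smooth_field_on U X -> smooth_field_on U Y.
Proof.
move=> oU XY XU phi aphi k; apply: Ck_on_eq (XU phi aphi k).
  exact: open_chart_image.
by move=> _ [x [dx Ux] <-] /=; rewrite chart_funK // XY.
Qed.

Lemma smooth_field_on0 U : smooth_field_on U (fun _ => 0 : 'rV[R]_n).
Proof.
move=> phi aphi k; rewrite (_ : (fun _ => _) = cst 0); first exact: Ck_on_cst.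
by apply/funext => u; rewrite /= mul0mx.
Qed.

Lemma smooth_field_on_scale U (r : M -> R) X : open U ->
  smooth_fun_on U r -> smooth_field_on U X ->
  smooth_field_on U (fun x => r x *: X x).
Proof.
move=> oU rU XU phi aphi k; have oI := open_chart_image (phi := phi) oU.
apply: (Ck_on_eq oI _ (Ck_on_scale oI (rU phi aphi k) (XU phi aphi k))).
by move=> u _ /=; rewrite scalemxAl.
Qed.

Lemma smooth_field_on_sum U I (s : seq I) (P : pred I)
    (F : I -> M -> 'rV[R]_n) : open U ->
  (forall i, P i -> smooth_field_on U (F i)) ->
  smooth_field_on U (fun x => \sum_(i <- s | P i) F i x).
Proof.
move=> oU FU phi aphi k; have oI := open_chart_image (phi := phi) oU.
apply: (Ck_on_eq oI _ (Ck_on_sum s oI (fun i Pi => FU i Pi phi aphi k))).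
by move=> u _ /=; rewrite mulmx_suml.
Qed.

Lemma smooth_fun_on_cst U (c : R) : smooth_fun_on U (fun _ => c).
Proof. by move=> phi aphi k; apply: Ck_on_cst. Qed.

(** The components, in one chart, of the coordinate fields of another chart
    are the entries of the inverse of a Jacobian matrix. *)
Lemma smooth_frame psi i : atlas psi ->
  smooth_field_on (chart_dom psi) (fun x => row i (frame_mx psi x)).
Proof.
move=> apsi phi aphi k; set I := phi @` _.
have oI : open I by apply: open_chart_image; exact: chart_dom_open.
pose f := psi \o chart_inv phi.
have [df Df] := atlas_compat aphi apsi k.+1.
have fI : Ck_on k I (fun u => jacobian f u).
  apply: Ck_on_mx => // a b.
  apply: (Ck_on_eq oI _ (Ck_on_coord 0 b oI (Df (delta_mx 0 a)))) => u Iu.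
  rewrite deriveEjacobian; last exact: df.
  by rewrite -rowE mxE.
have jacE x : chart_dom phi x -> chart_dom psi x ->
    transition_mx psi phi x *m jacobian f (phi x) = 1%:M.
  move=> dphi dpsi; rewrite -/(transition_mx phi psi x) transition_mxM //.
  exact: transition_mx_id.
have unit_jac u : I u -> jacobian f u \in unitmx.
  by move=> [x [dphi dpsi] <-]; have /mulmx1_unit[] := jacE x dphi dpsi.
have VI := Ck_on_invmx oI unit_jac fI.
have cI := Ck_on_cst k I (delta_mx 0 i : 'rV[R]_n).
apply: (Ck_on_eq oI _ (Ck_on_mulmx oI cI VI)) => _ [x [dphi dpsi] <-] /=.
rewrite chart_funK //.
have [ac dc] := (chart_at_atlas x, chart_at_dom x).
rewrite rowE -mulmxA /frame_mx /coord_mx transition_mxM //; congr (_ *m _).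
have u_x : jacobian f (phi x) \in unitmx by apply: unit_jac; exists x.
by apply: (can_inj (mulmxK u_x)); rewrite jacE // mulVmx.
Qed.

Lemma smooth_fun_on_continuous U (r : M -> R) x :
  U x -> smooth_fun_on U r -> {for x, continuous r}.
Proof.
move=> Ux rU; have [ac dc] := (chart_at_atlas x, chart_at_dom x).
set phi := chart_at x in ac dc.
have cr : {for phi x, continuous (r \o chart_inv phi)}.
  by have := rU phi ac 0; apply; exists x.
have cphi := chart_fun_cont dc.
have near_r : \forall y \near x, ((r \o chart_inv phi) \o phi) y = r y.
  have : open_nbhs x (chart_dom phi) by split=> //; exact: chart_dom_open.
  by move=> /open_nbhs_nbhs; apply: filterS => y dy; rewrite /= chart_funK.
have crx : ((r \o chart_inv phi) \o phi) y @[y --> x] --> r x.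
  by rewrite -[X in _ --> X](nbhs_singleton near_r); exact: continuous_comp.
apply: cvg_trans crx; exact: near_eq_cvg.
Qed.

End ManifoldCalculus.

(** * Extension of local sections *)

Section Extension.
Local Open Scope classical_set_scope.
Context {R : realType} {n : nat} {M : smooth_manifold R n}.
Implicit Types (phi psi : chart R n M) (U : set M) (X Y : M -> 'rV[R]_n).

Lemma smooth_fun_on_local U (r : M -> R) :
  (forall x, U x -> exists2 A, A x & smooth_fun_on A r) -> smooth_fun_on U r.
Proof.
move=> rU phi aphi k; apply: Ck_on_local => _ [x [dx /rU[A Ax rA]] <-].
by exists (phi @` (chart_dom phi `&` A)); [exists x|apply: rA].
Qed.

Lemma smooth_fun_on_eq U (r s : M -> R) : open U ->
  (forall x, U x -> r x = s x) -> smooth_fun_on U r -> smooth_fun_on U s.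
Proof.
move=> oU rs rU phi aphi k; apply: Ck_on_eq (rU phi aphi k).
  exact: open_chart_image.
by move=> _ [x [dx Ux] <-] /=; rewrite chart_funK // rs.
Qed.

(** The compact set is the preimage of a closed ball; the radius is kept in
    the statement because it fixes the scale of the bump function. *)
Lemma compact_chart_ball (x : M) U : open U -> U x ->
  exists2 d : R, 0 < d &
  exists2 K : set M, compact K /\ K `<=` chart_dom (chart_at x) `&` U &
    forall y, chart_dom (chart_at x) y ->
      `|chart_at x y - chart_at x x| <= d -> K y.
Proof.
move=> oU Ux; set phi := chart_at x; have dx : chart_dom phi x := chart_at_dom x.
have : nbhs (phi x) (phi @` (chart_dom phi `&` U)).
  by apply: open_nbhs_nbhs; split; [apply: open_chart_image|exists x].
move=> /nbhs_closedballP[d dI].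
set B := closed_ball _ _ in dI.
exists d%:num => //; exists (chart_inv phi @` B).
  split; last by move=> _ [u /dI[y [dy Uy] <-] <-]; rewrite chart_funK.
  apply: continuous_compact.
    apply: continuous_in_subspaceT => u; rewrite inE => /dI[y [dy Uy] <-].
    exact: chart_inv_cont.
  apply: bounded_closed_compact; last exact: closed_ball_closed.
  exists (`|phi x| + d%:num); split; first exact: num_real.
  move=> c /ltW dc u; rewrite /B closed_ballE // /closed_ball_ /= => du.
  apply: le_trans dc.
  rewrite -[u](subrK (phi x)) addrC; apply: le_trans (ler_normD _ _) _.
  by rewrite lerD2l distrC.
move=> y dy yd; exists (phi y); last by rewrite chart_funK.
by rewrite /B closed_ballE // /closed_ball_ /= distrC.
Qed.

(** In the chart at [x] the function is [flat 0 (d ^+ 2 - e2 u)] with [e2] the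
    squared Euclidean distance to the image of [x]; it is extended by zero.
    The extension is smooth because the support is compact, hence closed as
    the manifold is Hausdorff. *)
Lemma bump_function (x : M) U : open U -> U x ->
  exists r : M -> R, [/\ smooth_fun_on setT r, r x = 1 &
    exists2 K, closed K /\ K `<=` U & forall y, ~ K y -> r y = 0].
Proof.
move=> oU Ux; have [d d0 [K [cK KU] Kball]] := compact_chart_ball oU Ux.
set phi := chart_at x in KU Kball.
have [ac dc] : atlas phi /\ chart_dom phi x.
  by split; [apply: chart_at_atlas|apply: chart_at_dom].
have oD : open (chart_dom phi) by exact: chart_dom_open.
pose e2 (u : 'rV[R]_n) := \sum_j (u 0 j - phi x 0 j) * (u 0 j - phi x 0 j).
pose b u := flat 0 (d ^+ 2 - e2 u).
pose r y := if `[< chart_dom phi y >] then b (phi y) else 0.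
have clK : closed K by apply: compact_closed cK; exact: carrier_hausdorff.
have r0 y : ~ K y -> r y = 0.
  move=> nKy; rewrite /r; case: asboolP => // dy.
  apply: contra_notP nKy => /eqP b0; apply: Kball => //.
  have : 0 < b (phi y) by rewrite lt0r b0 flat_ge0.
  rewrite flat_gt0 subr_gt0 => ed.
  (* The norm of a row is its largest entry in absolute value, which is at
     most the Euclidean norm. *)
  rewrite [leLHS]/Num.norm /= mx_normrE; apply: bigmax_le => [|[i j] _] /=.
    exact: ltW.
  rewrite ord1 !mxE -ler_sqr ?nnegrE ?normr_ge0 ?(ltW d0) //.
  rewrite real_normK ?num_real //.
  apply: le_trans (ltW ed); rewrite /e2 (bigD1 j) //= expr2 lerDl.
  by apply: sumr_ge0 => l _; rewrite -expr2 sqr_ge0.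
have rx : 0 < r x.
  rewrite /r; case: asboolP => // _; rewrite flat_gt0 /e2 big1 ?subr0 ?exprn_gt0 //.
  by move=> j _; rewrite subrr mul0r.
have rS : smooth_fun_on setT r.
  apply: smooth_fun_on_local => y _.
  have [dy|ndy] := pselect (chart_dom phi y).
    exists (chart_dom phi) => // psi apsi k; set I := psi @` _.
    have oI : open I by apply: open_chart_image.
    pose f := phi \o chart_inv psi.
    have fI : Ck_on k I f by apply: atlas_compat.
    have fjI j : Ck_on k I (fun u => f u 0 j - phi x 0 j).
      have cI := Ck_on_cst k I (- phi x 0 j : R).
      exact: Ck_onD oI (Ck_on_coord 0 j oI fI) cI.
    have e2I : Ck_on k I (fun u => -1 * e2 (f u)).
      apply: Ck_onM => //; first exact: Ck_on_cst.
      by apply: Ck_on_sum => // j _; apply: Ck_onM.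
    have := Ck_on_flat 0 oI (Ck_onD oI (Ck_on_cst k I (d ^+ 2 : R)) e2I).
    apply: Ck_on_eq => // _ [z [dz dz'] <-] /=.
    by rewrite /r /cst /f /= chart_funK // mulN1r; case: asboolP.
  exists (~` K); first by move=> /KU[].
  apply: (smooth_fun_on_eq _ _ (smooth_fun_on_cst _ 0)).
    exact: closed_openC.
  by move=> z /= nKz; rewrite r0.
exists (fun y => (r x)^-1 * r y); split.
- move=> psi apsi k; apply: Ck_onM; last exact: rS.
    by apply: open_chart_image; exact: openT.
  exact: Ck_on_cst.
- by rewrite mulVf // gt_eqF.
- exists K; first by split=> // y /KU[].
  by move=> y /r0 ->; rewrite mulr0.
Qed.

(** The extension is [X] times a bump function; being proportional to [X], it
    stays in any distribution that [X] is a section of. *)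
Lemma smooth_field_extend (x : M) U X : open U -> U x ->
  smooth_field_on U X ->
  exists Y, [/\ smooth_field Y, Y x = X x,
    forall y, U y -> (Y y <= X y)%MS & forall y, ~ U y -> Y y = 0].
Proof.
move=> oU Ux XU; have [r [rS rx [K [clK KU] rK]]] := bump_function oU Ux.
pose Y y := if `[< U y >] then r y *: X y else 0.
exists Y; split.
- apply: smooth_field_on_local => y _; have [Uy|nUy] := pselect (U y).
    exists U => //; have rU : smooth_fun_on U r.
      move=> phi aphi k; apply: Ck_on_sub (rS phi aphi k).
      by apply: image_subset; apply: setIS.
    apply: smooth_field_on_eq (smooth_field_on_scale oU rU XU) => // z Uz.
    by rewrite /Y; case: asboolP.
  exists (~` K); first by move=> /KU.
  apply: smooth_field_on_eq (smooth_field_on0 _); first exact: closed_openC.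
  by move=> z nKz; rewrite /Y rK // scale0r; case: ifP.
- by rewrite /Y; case: asboolP => // _; rewrite rx scale1r.
- by move=> y Uy; rewrite /Y; case: asboolP => // _; rewrite scalemx_sub.
- by move=> y nUy; rewrite /Y; case: asboolP.
Qed.

(** Sections are global, while a distribution is given by local frames: this
    is what lets a condition on all sections be read pointwise. *)
Lemma sections_at (D : M -> 'M[R]_n) (x : M) (u : 'rV[R]_n) :
  Defs.distribution D -> (u <= D x)%MS ->
  exists2 X, sections D X & X x = u.
Proof.
move=> [k [_ /(_ x)[U [oU Ux [Z [ZU ZD]]]]]] uD.
have /submxP[c uE] : (u <= \matrix_(i < k) Z i x)%MS by rewrite -(eqmxP (ZD x Ux)).
pose X y := \sum_i c 0 i *: Z i y.
have XU : smooth_field_on U X.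
  apply: smooth_field_on_sum => // i _; apply: smooth_field_on_scale => //.
  exact: smooth_fun_on_cst.
have [Y [sY Yx YX Y0]] := smooth_field_extend oU Ux XU.
exists Y; last first.
  rewrite Yx uE mulmx_sum_row; apply: eq_bigr => i _.
  by congr (_ *: _); apply/rowP => j; rewrite !mxE.
split=> // y; have [Uy|nUy] := pselect (U y); last by rewrite Y0 // sub0mx.
apply: submx_trans (YX y Uy) _; rewrite (eqmxP (ZD y Uy)).
apply: summx_sub => i _; apply: scalemx_sub.
by rewrite -[Z i y](rowK (fun i => Z i y)) row_sub.
Qed.

End Extension.

Section Metric.
Local Open Scope classical_set_scope.
Context {R : realType} {n : nat} {M : riemannian_manifold R n}.

Lemma change_of_frame (C F g : 'M[R]_n) (u v : 'rV[R]_n) : C *m F = 1%:M ->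
  u *m C *m (F *m g *m F^T) *m (v *m C)^T = u *m g *m v^T.
Proof.
move=> CF; rewrite trmx_mul !mulmxA -(mulmxA u) CF mulmx1.
by rewrite -!mulmxA (mulmxA F^T) -trmx_mul CF trmx1 mul1mx.
Qed.

(** Components in the current chart enter through [coord_mx], and those of the
    metric through [frame_mx], its inverse. *)
Lemma smooth_inner (U : set M) (X Y : M -> 'rV[R]_n) : open U ->
  smooth_field_on U X -> smooth_field_on U Y ->
  smooth_fun_on U (fun x => inner (metric x) (X x) (Y x)).
Proof.
move=> oU XU YU phi aphi k; have oI := open_chart_image (phi := phi) oU.
have gI := @metric_smooth _ _ M phi aphi k.
have {}gI :=
  Ck_on_sub (@image_subset _ _ phi _ _ (@subIsetl _ (chart_dom phi) U)) gI.
have := Ck_on_mulmx oI (Ck_on_mulmx oI (XU phi aphi k) gI)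
  (Ck_on_tr oI (YU phi aphi k)).
move=> /(Ck_on_coord 0 0 oI); apply: Ck_on_eq => // _ [x [dx Ux] <-] /=.
rewrite chart_funK // /inner; congr (fun_of_matrix _ 0 0).
exact: change_of_frame (coord_frame_mx aphi dx).
Qed.

End Metric.

(** * Orthogonal complement of a distribution *)

Section InnerProductSpace.
Context {R : realType} {n : nat} (G : 'M[R]_n).
Implicit Types (u v w : 'rV[R]_n) (a : R).

Lemma innerDl u v w : inner G (u + v) w = inner G u w + inner G v w.
Proof. by rewrite /inner !mulmxDl mxE. Qed.

Lemma innerDr u v w : inner G w (u + v) = inner G w u + inner G w v.
Proof. by rewrite /inner linearD /= mulmxDr mxE. Qed.

Lemma innerZl a u w : inner G (a *: u) w = a * inner G u w.
Proof. by rewrite /inner -!scalemxAl mxE. Qed.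

Lemma innerBl u v w : inner G (u - v) w = inner G u w - inner G v w.
Proof. by rewrite /inner !mulmxBl !mxE. Qed.

Lemma inner0l w : inner G 0 w = 0.
Proof. by rewrite /inner !mul0mx mxE. Qed.

Lemma orth_complP k (W : 'M[R]_(k, n)) u :
  reflect (forall w, (w <= W)%MS -> inner G u w = 0) (u <= orth_compl G W)%MS.
Proof.
apply: (iffP sub_kermxP) => [uW w /submxP[c ->]|uW].
  rewrite /inner trmx_mul mulmxA -(mulmxA u) uW.
  by rewrite mul0mx mxE.
apply/rowP => i; rewrite mulmxA [RHS]mxE -(uW (row i W)) ?row_sub //.
by rewrite /inner tr_row colE mulmxA -colE [RHS]mxE.
Qed.

Lemma sub_orth_compl k l (W : 'M[R]_(k, n)) (A : 'M[R]_(l, n)) :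
  (forall u w, (u <= A)%MS -> (w <= W)%MS -> inner G u w = 0) ->
  (A <= orth_compl G W)%MS.
Proof.
move=> AW; apply/row_subP => i; apply/orth_complP => w.
by apply: AW; exact: row_sub.
Qed.

Hypothesis G_gt0 : forall u, u != 0 -> 0 < inner G u u.

Lemma inner_ge0 u : 0 <= inner G u u.
Proof. by have [->|/G_gt0/ltW//] := eqVneq u 0; rewrite inner0l. Qed.

Lemma inner_eq0 u : (inner G u u == 0) = (u == 0).
Proof.
have [->|u0] := eqVneq u 0; first by rewrite inner0l eqxx.
by rewrite gt_eqF // G_gt0.
Qed.

Lemma gram_unitmx k (Q : 'M[R]_(k, n)) :
  row_free Q -> Q *m G *m Q^T \in unitmx.
Proof.
move=> freeQ; rewrite -row_free_unit -kermx_eq0 -submx0.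
apply/rV_subP => u /sub_kermxP uQ; suff : u *m Q == 0.
  by rewrite mulmx_free_eq0 // submx0.
rewrite -inner_eq0 /inner trmx_mul.
by rewrite mulmxA -(mulmxA u) -(mulmxA u) uQ mul0mx mxE.
Qed.

Lemma inner_unitmx : G \in unitmx.
Proof.
have := @gram_unitmx n 1%:M; rewrite mul1mx trmx1 mulmx1; apply.
by rewrite row_free_unit unitmx1.
Qed.

Lemma orth_compl_rank k (W : 'M[R]_(k, n)) :
  \rank (orth_compl G W) = (n - \rank W)%N.
Proof.
rewrite /orth_compl mxrank_ker; congr (_ - _)%N.
rewrite -mxrank_tr trmx_mul trmxK; apply: mxrankMfree.
by rewrite row_free_unit unitmx_tr inner_unitmx.
Qed.

Lemma cap_orth_compl k (W : 'M[R]_(k, n)) : (W :&: orth_compl G W)%MS = 0.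
Proof.
apply/eqP; rewrite -submx0; apply/rV_subP => u; rewrite sub_capmx.
move=> /andP[uW /orth_complP/(_ u uW)/eqP].
by rewrite inner_eq0 submx0.
Qed.

Lemma add_orth_compl k (W : 'M[R]_(k, n)) : (1%:M <= W + orth_compl G W)%MS.
Proof.
rewrite sub1mx /row_full; have := mxrank_sum_cap W (orth_compl G W).
rewrite cap_orth_compl mxrank0 addn0 orth_compl_rank => ->.
by rewrite subnKC // rank_leq_col.
Qed.

Lemma orth_decomp k (W : 'M[R]_(k, n)) u : exists2 v,
  (v <= W)%MS & (u - v <= orth_compl G W)%MS.
Proof.
have /sub_addsmxP[c ->] : (u <= W + orth_compl G W)%MS.
  by apply: submx_trans (add_orth_compl W); exact: submx1.
exists (c.1 *m W); rewrite ?submxMl // addrAC subrr add0r submxMl //.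
Qed.

(** The shape in which projections onto a subspace are computed: it is enough
    to exhibit the decomposition. *)
Lemma orth_projE k (W : 'M[R]_(k, n)) v w :
  (v <= W)%MS -> (w <= orth_compl G W)%MS -> (v + w) *m orth_proj G W = v.
Proof.
move=> vW wW; have cap0 : (<<W>> :&: orth_compl G W = 0)%MS.
  apply/eqP; rewrite -submx0 (cap_eqmx (genmxE W) (eqmx_refl _)).
  by rewrite cap_orth_compl.
by rewrite /orth_proj mulmxDl proj_mx_id ?genmxE // proj_mx_0 // addr0.
Qed.

End InnerProductSpace.

Section OrthogonalDistribution.
Local Open Scope classical_set_scope.
Context {R : realType} {n : nat} {M : riemannian_manifold R n}.

Lemma smooth_fun_adj (U : set M) k (A : M -> 'M[R]_k) : open U ->
  (forall i j, smooth_fun_on U (fun x => A x i j)) ->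
  forall i j, smooth_fun_on U (fun x => \adj (A x) i j).
Proof.
move=> oU AU i j phi aphi l; have oI := open_chart_image (phi := phi) oU.
have := Ck_on_adj oI (Ck_on_mx oI (fun a b => AU a b phi aphi l)).
exact: Ck_on_coord.
Qed.

Lemma smooth_fun_det (U : set M) k (A : M -> 'M[R]_k) : open U ->
  (forall i j, smooth_fun_on U (fun x => A x i j)) ->
  smooth_fun_on U (fun x => \det (A x)).
Proof.
move=> oU AU phi aphi l; have oI := open_chart_image (phi := phi) oU.
exact: Ck_on_det oI (Ck_on_mx oI (fun a b => AU a b phi aphi l)).
Qed.

(** Up to the factor [\det S], the rows of [\adj S *m Q] are the dual frame of
    [Q], so the last ones are orthogonal to the first rows of [Q].  Working
    with the adjugate keeps every entry polynomial in those of [Q] and [G]. *)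
Lemma dual_frame_orth (G : 'M[R]_n) k l (Q : 'M[R]_(k + l, n)) :
  let S := Q *m G *m Q^T in let W := dsubmx (\adj S *m Q) in
  \det S != 0 -> row_free W /\ W *m G *m (usubmx Q)^T = 0.
Proof.
move=> S W dS; have : \adj S *m Q *m G *m Q^T = (\det S)%:M.
  by rewrite -!mulmxA [Q *m _]mulmxA mul_adj_mx.
rewrite -[\adj S *m Q]vsubmxK -/W -{2}[Q]vsubmxK tr_col_mx mul_col_mx.
rewrite mul_col_row scalar_mx_block => /eq_block_mx[_ _ W0 W1]; split=> //.
apply/row_freeP; exists (G *m (dsubmx Q)^T *m ((\det S)^-1)%:M).
by rewrite !mulmxA W1 -scalar_mxM mulfV.
Qed.

(** A local frame of [D] is completed by constant combinations of coordinate
    fields.  They complete it at [x], hence wherever the Gram determinant does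
    not vanish, which is a neighbourhood of [x]; the dual frame then yields a
    frame of the complement. *)
Lemma orth_distribution (D : M -> 'M[R]_n) : Defs.distribution D ->
  Defs.distribution (fun x => orth_compl (metric x) (D x)).
Proof.
move=> [k [rD locD]]; exists (n - k)%N.
have g_gt0 := @metric_posdef _ _ M.
split=> [x|x]; first by rewrite (orth_compl_rank (g_gt0 x)) rD.
have [U [oU Ux [Z [ZU DZ]]]] := locD x.
pose A y := \matrix_(i < k) Z i y.
have [C freeC] : exists C : 'M[R]_(n - k, n), row_free (col_mx (A x) C).
  have rA : \rank (A x) = k by rewrite -(eqmxP (DZ x Ux)) rD.
  have : \rank (A x)^C%MS = (n - k)%N by rewrite mxrank_compl rA.
  move=> <-; exists (row_base (A x)^C%MS).
  rewrite /row_free -addsmxE (adds_eqmx (eqmx_refl _) (eq_row_base _)).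
  have /eqP -> := addsmx_compl_full (A x).
  by rewrite mxrank_compl rA subnKC // -rA rank_leq_col.
pose psi := chart_at x.
have [apsi dpsi] : atlas psi /\ chart_dom psi x.
  by split; [apply: chart_at_atlas|apply: chart_at_dom].
pose U1 := U `&` chart_dom psi.
have oU1 : open U1 by apply: openI => //; exact: chart_dom_open.
pose V i y := match fintype.split i with
  | inl a => Z a y
  | inr b => \sum_l C b l *: row l (frame_mx psi y) end.
have VU i : smooth_field_on U1 (V i).
  rewrite /V; case: fintype.split => [a|b].
    by apply: smooth_field_on_sub (ZU a) => y [].
  apply: smooth_field_on_sum => // l _; apply: smooth_field_on_scale => //.
    exact: smooth_fun_on_cst.
  by apply: smooth_field_on_sub (smooth_frame l apsi) => y [].
pose Q y := \matrix_i V i y.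
have QA y : usubmx (Q y) = A y.
  by apply/matrixP => i j; rewrite !mxE /V (unsplitK (inl i)).
have Qx : Q x = col_mx (A x) C.
  rewrite -[Q x]vsubmxK QA; congr col_mx; apply/row_matrixP => i.
  apply/rowP => j; rewrite !mxE /V (unsplitK (inr i)) summxE.
  rewrite (bigD1 j) //= big1 ?addr0 => [|l lj]; rewrite /frame_mx transition_mx_id //.
    by rewrite !mxE eqxx mulr1.
  by rewrite !mxE (negbTE lj) mulr0.
pose S y := Q y *m metric y *m (Q y)^T.
have SU i j : smooth_fun_on U1 (fun y => S y i j).
  apply: smooth_fun_on_eq (smooth_inner oU1 (VU i) (VU j)) => // y _.
  rewrite /inner /S -[V i y](rowK (V^~ y)) -[V j y](rowK (V^~ y)).
  by rewrite tr_row rowE colE !mulmxA -colE mxE -!mulmxA -rowE mxE.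
have dSx : \det (S x) != 0.
  by have := gram_unitmx (g_gt0 x) freeC; rewrite -Qx unitmxE unitfE.
have cS : {for x, continuous (fun y => \det (S y))}.
  by apply: (smooth_fun_on_continuous (U := U1)) => //; exact: smooth_fun_det.
have [A' [oA' xA'] SA'] : exists2 A', open_nbhs x A' &
    forall y, A' y -> \det (S y) != 0.
  have : nbhs x [set y | \det (S y) != 0] by exact: cvgr_neq0 cS dSx.
  by rewrite nbhsE => -[A' oA' SA']; exists A'.
exists (U1 `&` A'); split; [exact: openI| by split|].
pose W (j : 'I_(n - k)) y := \sum_i \adj (S y) (rshift k j) i *: V i y.
have WE y : \matrix_j W j y = dsubmx (\adj (S y) *m Q y).
  apply/row_matrixP => j; rewrite rowK; apply/rowP => l.
  rewrite !mxE summxE; apply: eq_bigr => i _; by rewrite !mxE.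
exists W; split=> [j|y [[Uy _] A'y]].
  apply: (@smooth_field_on_sub _ _ _ U1); first by move=> y [].
  apply: smooth_field_on_sum => // i _; apply: smooth_field_on_scale => //.
  exact: smooth_fun_adj.
rewrite WE; have [freeW W0] := dual_frame_orth (SA' y A'y).
set w := dsubmx _ in freeW W0 *.
have wD : (w <= orth_compl (metric y) (D y))%MS.
  have wA : (w <= orth_compl (metric y) (A y))%MS.
    by apply/sub_kermxP; rewrite mulmxA -QA.
  apply: sub_orth_compl => u v uw vD.
  apply/(orth_complP _ _ _ (submx_trans uw wA)).
  by rewrite -(eqmxP (DZ y Uy)).
rewrite andbC wD /=; have [_ <-] := mxrank_leqif_sup wD.
rewrite (orth_compl_rank (g_gt0 y)) rD; exact: freeW.
Qed.

End OrthogonalDistribution.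

(** * Tangential and normal parts of the structure at a point *)

Section TangentOperator.
Context {R : realType} {p q n' n : nat}.
Context {M : riemannian_manifold R n'} {Mbar : riemannian_manifold R n}.
Variables (f : M -> Mbar) (J : Mbar -> 'M[R]_n).
Hypotheses (q_gt0 : (0 < q)%N) (metallic : metallic_structure p q J)
  (immersed : isometric_immersion f).
Variable x : M.
Implicit Types (u v w : 'rV[R]_n') (D : 'M[R]_n') (lam : R).

Let F : 'M[R]_(n', n) := differential f x.
Let Jx : 'M[R]_n := J (f x).
Let G : 'M[R]_n := metric (f x).
Let g : 'M[R]_n' := metric x.
Let T : 'M[R]_n' := tan_part f J x.
Let N : 'M[R]_(n', n) := nor_part f J x.

Let G_gt0 : forall w : 'rV[R]_n, w != 0 -> 0 < inner G w w.
Proof. exact: metric_posdef. Qed.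

Let g_gt0 : forall u, u != 0 -> 0 < inner g u u.
Proof. exact: metric_posdef. Qed.

Let GC (w z : 'rV[R]_n) : inner G w z = inner G z w.
Proof. exact: (Defs.metric_sym (f x)). Qed.

Let gC u v : inner g u v = inner g v u.
Proof. exact: (Defs.metric_sym x). Qed.

Let F_free : row_free F.
Proof. by have [_ free_df _] := immersed; apply: free_df. Qed.

Let gE u v : inner g u v = inner G (u *m F) (v *m F).
Proof. by have [_ _ isom] := immersed; apply: isom. Qed.

Let cap0 : (<<F>> :&: orth_compl G F = 0)%MS.
Proof.
apply/eqP; rewrite -submx0 (cap_eqmx (genmxE F) (eqmx_refl _)).
by rewrite cap_orth_compl.
Qed.

(** The metric being definite, the ambient tangent space is the sum of the
    tangent space of [M] and its orthogonal complement. *)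
Lemma structure_decomp u : u *m F *m Jx = u *m T *m F + u *m N.
Proof.
have full : (F *m Jx <= <<F>> + orth_compl G F)%MS.
  apply: submx_trans (submx1 _) _; rewrite (adds_eqmx (genmxE F) (eqmx_refl _)).
  exact: add_orth_compl.
have TF : T *m F = F *m Jx *m proj_mx <<F>>%MS (orth_compl G F).
  by rewrite mulmxKpV // -(genmxE F) proj_mx_sub.
rewrite -(mulmxA u F) -(mulmxA u T) TF -mulmxDr; congr (_ *m _).
by rewrite add_proj_mx.
Qed.

Lemma nor_part_orth u v : inner G (u *m N) (v *m F) = 0.
Proof.
apply: (orth_complP G F _ _); last exact: submxMl.
by rewrite /N /nor_part mulmxA; exact: proj_mx_sub.
Qed.

Lemma inner_tan_part u v : inner g (u *m T) v = inner G (u *m F *m Jx) (v *m F).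
Proof. by rewrite gE structure_decomp innerDl nor_part_orth addr0. Qed.

Lemma tan_part_selfadjoint u v : inner g (u *m T) v = inner g u (v *m T).
Proof.
have [_ _ Jsym] := metallic.
by rewrite [RHS]gC !inner_tan_part Jsym GC.
Qed.

(** Since [J] is self-adjoint with [J ^+ 2 = p J + q], the form [<J u, J v>]
    only involves the tangential operator [T].  This turns the slant condition,
    a comparison of [T u] with [J u], into an equation about [T] alone. *)
Lemma inner_structure u v : inner G (u *m F *m Jx) (v *m F *m Jx) =
  inner g (p%:R *: (u *m T) + q%:R *: u) v.
Proof.
have [_ J2 Jsym] := metallic.
rewrite -Jsym J2 [RHS]innerDl !innerZl innerDl !innerZl.
by rewrite inner_tan_part gE.
Qed.

Lemma structure_pythagoras u : inner G (u *m F *m Jx) (u *m F *m Jx) =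
  inner g (u *m T) (u *m T) + inner G (u *m N) (u *m N).
Proof.
rewrite structure_decomp innerDl !innerDr nor_part_orth add0r.
by rewrite (GC _ (u *m N)) nor_part_orth addr0 gE.
Qed.

(** [J] is invertible, with inverse [(J - p) / q]. *)
Lemma structure_free y : row_free (J y).
Proof.
have [_ J2 _] := metallic.
rewrite -kermx_eq0 -submx0; apply/rV_subP => w /sub_kermxP wJ.
have := J2 y w; rewrite wJ mul0mx scaler0 add0r => /esym/eqP.
by rewrite scaler_eq0 pnatr_eq0 gtn_eqF //= submx0.
Qed.

Lemma structure_gt0 u : u != 0 -> 0 < inner G (u *m F *m Jx) (u *m F *m Jx).
Proof.
move=> u0; apply: G_gt0; rewrite mulmx_free_eq0 ?structure_free //.
by rewrite mulmx_free_eq0.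
Qed.

Lemma tan_nor_of_tangent u v :
  u *m F *m Jx = v *m F -> u *m T = v /\ u *m N = 0.
Proof.
move=> uv; have uN : u *m N = 0.
  apply/eqP; rewrite -(inner_eq0 G_gt0).
  have -> : inner G (u *m N) (u *m N) = inner G (u *m N) ((v - u *m T) *m F).
    by rewrite mulmxBl -uv structure_decomp addrAC subrr add0r.
  by rewrite nor_part_orth.
split=> //; apply: (row_free_inj F_free).
by rewrite -uv structure_decomp uN addr0.
Qed.

Definition tan_stable D := forall u, (u <= D)%MS -> (u *m T <= D)%MS.

Definition tan_eigen lam u : Prop :=
  u *m T *m T = lam *: (p%:R *: (u *m T) + q%:R *: u).

Lemma tan_eigenB lam u v :
  tan_eigen lam u -> tan_eigen lam v -> tan_eigen lam (u - v).
Proof.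
rewrite /tan_eigen !mulmxBl => -> ->; rewrite -scalerBr; congr (_ *: _).
by rewrite !scalerBr opprD addrACA.
Qed.

Lemma tan_eigen_stable lam u : tan_eigen lam u -> tan_eigen lam (u *m T).
Proof.
rewrite /tan_eigen => uE; rewrite {1}uE.
by rewrite -scalemxAl mulmxDl -!scalemxAl.
Qed.

Lemma tan_eigen_norm lam u : tan_eigen lam u ->
  inner g (u *m T) (u *m T) = lam * inner G (u *m F *m Jx) (u *m F *m Jx).
Proof.
by move=> uE; rewrite -tan_part_selfadjoint uE innerZl inner_structure.
Qed.

(** Both sides are quadratic forms; polarizing them gives the operator
    identity, because [D] is stable. *)
Lemma tan_eigen_of_norm lam D : tan_stable D ->
  (forall u, (u <= D)%MS -> inner g (u *m T) (u *m T) =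
     lam * inner G (u *m F *m Jx) (u *m F *m Jx)) ->
  forall u, (u <= D)%MS -> tan_eigen lam u.
Proof.
move=> stD normD u uD; apply/eqP; rewrite -subr_eq0 -(inner_eq0 g_gt0).
set w := _ - _; have wD : (w <= D)%MS.
  rewrite addmx_sub ?stD // eqmx_opp scalemx_sub // addmx_sub // scalemx_sub //.
  exact: stD.
have -> : inner g w w = inner g (u *m T) (w *m T) -
    lam * inner G (u *m F *m Jx) (w *m F *m Jx).
  by rewrite -tan_part_selfadjoint inner_structure -innerZl -innerBl.
clearbody w; have := normD (u + w) (addmx_sub uD wD).
rewrite !mulmxDl !innerDl !innerDr.
rewrite (normD u uD) (normD w wD) (gC (w *m T) (u *m T)).
rewrite (GC (w *m F *m Jx) (u *m F *m Jx)) => E.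
by apply/eqP; lra.
Qed.

(** If [N u = 0], then [T u] and [J u] have the same norm, while the equation
    says that the squares of these norms are in the ratio [lam < 1]. *)
Lemma tan_eigen_nor0 lam u :
  lam < 1 -> tan_eigen lam u -> u *m N = 0 -> u = 0.
Proof.
move=> lam1 /tan_eigen_norm uE uN; apply/eqP/negPn/negP => u0.
have := structure_gt0 u0; have := structure_pythagoras u.
rewrite uE uN inner0l addr0 => E E0.
have /eqP : (1 - lam) * inner G (u *m F *m Jx) (u *m F *m Jx) = 0.
  by rewrite mulrBl mul1r -E subrr.
by rewrite mulf_eq0 subr_eq0 (gt_eqF lam1) (gt_eqF E0).
Qed.

(** [J u = T u + N u] with [T u] in [D] and [N u] normal to [M], so [T u] is
    the projection of [J u] onto [D]. *)
Lemma angle_tan_part D u : tan_stable D -> (u <= D)%MS ->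
  angle G (u *m F *m Jx) (D *m F) =
  acos (Num.sqrt (inner g (u *m T) (u *m T)) /
        Num.sqrt (inner G (u *m F *m Jx) (u *m F *m Jx))).
Proof.
move=> stD uD; have TuDF : (u *m T *m F <= D *m F)%MS by rewrite submxMr ?stD.
have Nu_orth : (u *m N <= orth_compl G (D *m F))%MS.
  apply/orth_complP => w /submxP[c ->].
  by rewrite (mulmxA c) nor_part_orth.
have := orth_projE G_gt0 TuDF Nu_orth; rewrite -structure_decomp.
by rewrite /angle /gnorm => ->; rewrite gE.
Qed.

Lemma cos_angle_tan_part D u : tan_stable D -> (u <= D)%MS -> u != 0 ->
  let c := cos (angle G (u *m F *m Jx) (D *m F)) in
  [/\ 0 <= c,
      inner g (u *m T) (u *m T) =
        c ^+ 2 * inner G (u *m F *m Jx) (u *m F *m Jx) &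
      angle G (u *m F *m Jx) (D *m F) = acos c].
Proof.
move=> stD uD u0; rewrite angle_tan_part //.
have JJ := structure_gt0 u0; have TT := inner_ge0 g_gt0 (u *m T).
have le_TJ := structure_pythagoras u.
have NN := inner_ge0 G_gt0 (u *m N).
set a := inner g _ _ in TT le_TJ *; set b := inner G _ _ in JJ le_TJ *.
have /andP[r0 r1] : 0 <= Num.sqrt a / Num.sqrt b <= 1.
  rewrite divr_ge0 ?sqrtr_ge0 // ler_pdivrMr ?sqrtr_gt0 // mul1r.
  by rewrite ler_sqrt ?(ltW JJ) //= le_TJ lerDl.
rewrite /= acosK; last by rewrite in_itv /= r1 (le_trans _ r0) // lerN10.
split=> //; rewrite expr_div_n (sqr_sqrtr TT) (sqr_sqrtr (ltW JJ)) divfK //.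
by rewrite gt_eqF.
Qed.

End TangentOperator.

(** * Semi-slant submanifolds *)

Section SemiSlant.
Context {R : realType} {p q m' m : nat} {Mbar : riemannian_manifold R m}.
Context {J : Mbar -> 'M[R]_m} {M : riemannian_manifold R m'} {f : M -> Mbar}.
Hypotheses (q_gt0 : (0 < q)%N) (metallic : metallic_structure p q J)
  (immersed : isometric_immersion f).
Implicit Type x : M.

(** Semi-slant submanifolds come with two orthogonal summands, neither of them
    given as the complement of the other; this recovers it. *)
Lemma sub_orth_summand x (D1 D2 : 'M[R]_m') (w : 'rV[R]_m') :
  (forall u v : 'rV[R]_m', (u <= D1)%MS -> (v <= D2)%MS ->
     inner (metric x) u v = 0) ->
  (1%:M <= D1 + D2)%MS ->
  (forall v : 'rV[R]_m', (v <= D2)%MS -> inner (metric x) w v = 0) ->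
  (w <= D1)%MS.
Proof.
move=> orth full wD2.
have /sub_addsmxP[c wE] := submx_trans (submx1 w) full.
have bD2 := submxMl c.2 D2; have aD1 := submxMl c.1 D1.
suff /eqP b0 : c.2 *m D2 == 0 by rewrite wE b0 addr0.
rewrite -(inner_eq0 (@metric_posdef _ _ M x)).
by have := wD2 _ bD2; rewrite {1}wE innerDl (orth _ _ aD1 bD2) add0r => ->.
Qed.

(** The slant angle being constant, [cos th ^+ 2] is the ratio of the squared
    norms of [T u] and [J u] on all of [D2]; polarization yields the equation on
    [D2].  Conversely, the component on [D1] of a solution is a solution with
    no normal part, hence vanishes. *)
Lemma semi_slant_eigen : semi_slant f J ->
  exists (lam : R) (D1 D2 : M -> 'M[R]_m'), [/\ 0 <= lam < 1, Defs.distribution D2,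
    forall x (w : 'rV[R]_m'),
      (forall v : 'rV[R]_m', (v <= D2 x)%MS -> inner (metric x) w v = 0) ->
      (w <= D1 x)%MS,
    forall x (u : 'rV[R]_m'), (u <= D1 x)%MS -> u *m nor_part f J x = 0 &
    forall x (u : 'rV[R]_m'),
      (u <= D2 x)%MS <-> tan_eigen (p := p) (q := q) f J x lam u].
Proof.
move=> [D1 [D2 [[dD1 dD2] orth full inv [th [th0 sl]]]]].
have full12 x : (1%:M <= D1 x + D2 x)%MS by have /andP[] := full x.
have inD1 x (w : 'rV[R]_m') :
    (forall v : 'rV[R]_m', (v <= D2 x)%MS -> inner (metric x) w v = 0) ->
    (w <= D1 x)%MS.
  exact: sub_orth_summand (orth x) (full12 x).
have inD2 x (w : 'rV[R]_m') :
    (forall v : 'rV[R]_m', (v <= D1 x)%MS -> inner (metric x) w v = 0) ->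
    (w <= D2 x)%MS.
  apply: sub_orth_summand; last by rewrite addsmxC.
  by move=> u v uD2 vD1; rewrite Defs.metric_sym orth.
have TN1 x (u : 'rV[R]_m') : (u <= D1 x)%MS ->
    (u *m tan_part f J x <= D1 x)%MS /\ u *m nor_part f J x = 0.
  move=> uD1; have /andP[invx _] := inv x.
  have : (u *m differential f x *m J (f x) <= D1 x *m differential f x)%MS.
    by apply: submx_trans invx; rewrite -!mulmxA submxMr.
  move=> /submxP[c]; rewrite mulmxA => E.
  have [-> ->] := tan_nor_of_tangent immersed E.
  by rewrite submxMl.
have stD2 x : tan_stable f J x (D2 x).
  move=> u uD2; apply: inD2 => v vD1.
  rewrite (tan_part_selfadjoint metallic immersed) Defs.metric_sym orth //.
  by have [] := TN1 x v vD1.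
have [lam lam01 normE] : exists2 lam, 0 <= lam < 1 &
    forall x (u : 'rV[R]_m'), (u <= D2 x)%MS ->
      inner (metric x) (u *m tan_part f J x) (u *m tan_part f J x) = lam *
        inner (metric (f x)) (u *m differential f x *m J (f x))
                             (u *m differential f x *m J (f x)).
  have [[x0 [u0 [u0D u0_neq0]]]|noD2] := pselect (exists x (u : 'rV[R]_m'),
      (u <= D2 x)%MS /\ u != 0); last first.
    (* If [D2] is zero everywhere, nothing is known of [th]: any value will do. *)
    exists 0; first by rewrite lexx ltr01.
    move=> x u uD2; have [->|u_neq0] := eqVneq u 0.
      by rewrite !mul0mx !inner0l mulr0.
    by exfalso; apply: noD2; exists x, u.
  exists (cos th ^+ 2).
    have [+ _ +] :=
      cos_angle_tan_part q_gt0 metallic immersed (stD2 x0) u0D u0_neq0.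
    rewrite /= sl // => c0 thE; rewrite sqr_ge0 /= expr_lt1 //.
    rewrite lt_neqAle cos_le1 andbT; apply: contra_neq th0 => c1.
    by rewrite thE c1 acos1.
  move=> x u uD2; have [->|u_neq0] := eqVneq u 0.
    by rewrite !mul0mx !inner0l mulr0.
  have [_ -> _] := cos_angle_tan_part q_gt0 metallic immersed (stD2 x) uD2 u_neq0.
  by rewrite sl.
have eigD2 x (u : 'rV[R]_m') :
    (u <= D2 x)%MS -> tan_eigen (p := p) (q := q) f J x lam u.
  exact: tan_eigen_of_norm (stD2 x) (normE x) u.
have lam1 : lam < 1 by case/andP: lam01.
exists lam, D1, D2; split=> // [x u uD1|x u]; first by have [] := TN1 x u uD1.
split=> [|uE]; first exact: eigD2.
have /sub_addsmxP[c uc] := submx_trans (submx1 u) (full12 x).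
have bD2 := submxMl c.2 (D2 x).
have aE : u - c.2 *m D2 x = c.1 *m D1 x by rewrite uc addrK.
have := tan_eigenB uE (eigD2 x _ bD2).
rewrite aE => /(tan_eigen_nor0 q_gt0 metallic immersed lam1) a0.
rewrite uc a0 ?add0r //; have [] := TN1 x (c.1 *m D1 x) (submxMl _ _) => //.
Qed.

(** All solutions of the equation lie in [D]: the difference of a solution and
    its projection onto [D] is a solution with no normal part.  The solutions
    are stable under [T], hence so are [D] and its complement, on which [J] and
    [T] agree. *)
Lemma eigen_semi_slant lam D :
  0 <= lam < 1 -> Defs.distribution D ->
  (forall x (u : 'rV[R]_m'),
     (u <= D x)%MS -> tan_eigen (p := p) (q := q) f J x lam u) ->
  (forall x (u : 'rV[R]_m'), (u <= orth_compl (metric x) (D x))%MS ->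
     u *m nor_part f J x = 0) ->
  semi_slant f J.
Proof.
move=> /andP[lam0 lam1] dD eigD nor0.
have g_gt0 := @metric_posdef _ _ M.
pose D1 x := orth_compl (metric x) (D x).
have inD x (u : 'rV[R]_m') :
    tan_eigen (p := p) (q := q) f J x lam u -> (u <= D x)%MS.
  move=> uE; have [v vD uvD1] := orth_decomp (g_gt0 x) (D x) u.
  have := tan_eigenB uE (eigD x v vD).
  move=> /(tan_eigen_nor0 q_gt0 metallic immersed lam1)/(_ (nor0 x _ uvD1)).
  by move=> /eqP; rewrite subr_eq0 => /eqP ->.
have stD x : tan_stable f J x (D x).
  by move=> u /eigD uE; apply/inD/tan_eigen_stable.
have orthD1 x (u v : 'rV[R]_m') : (u <= D1 x)%MS -> (v <= D x)%MS ->
    inner (metric x) u v = 0.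
  by move=> /orth_complP; apply.
have stD1 x : tan_stable f J x (D1 x).
  move=> u uD1; apply/orth_complP => v vD.
  rewrite (tan_part_selfadjoint metallic immersed); apply: orthD1 uD1 _.
  exact: stD.
exists D1, D; split=> //.
- by split=> //; exact: orth_distribution.
- by move=> x; rewrite submx1 /= addsmxC (add_orth_compl (g_gt0 x)).
- move=> x; set A := D1 x *m differential f x.
  have AJ : (A *m J (f x) <= A)%MS.
    apply/row_subP => i; rewrite 2!row_mul.
    have rD1 := row_sub i (D1 x).
    rewrite structure_decomp nor0 // addr0.
    by apply: submxMr; apply: stD1.
  rewrite AJ /=; have [_ <-] := mxrank_leqif_sup AJ.
  by rewrite mxrankMfree // (structure_free q_gt0 metallic (f x)).
- exists (acos (Num.sqrt lam)).
  have s01 : 0 <= Num.sqrt lam < 1.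
    by rewrite sqrtr_ge0 -sqrtr1 ltr_sqrt.
  have /andP[s0 s1] := s01.
  split=> [|x u uD u0].
    apply/eqP => a0; have : cos (acos (Num.sqrt lam)) = Num.sqrt lam.
      by rewrite acosK // in_itv /= (ltW s1) (le_trans _ s0) // lerN10.
    by rewrite a0 cos0 => E; rewrite -E ltxx in s1.
  rewrite (angle_tan_part immersed (stD x) uD).
  rewrite (tan_eigen_norm metallic immersed (eigD x u uD)) sqrtrM // mulfK //.
  by rewrite gt_eqF // sqrtr_gt0 (structure_gt0 q_gt0 metallic immersed).
Qed.

End SemiSlant.

Theorem proposition13 (R : realType) (p q m' m : nat)
    (p_gt0 : (0 < p)%N) (q_gt0 : (0 < q)%N)
    (m'_gt0 : (1 <= m')%N) (m'_lt_m : (m' < m)%N)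
    (Mbar : riemannian_manifold R m) (J : Mbar -> 'M[R]_m)
    (metallic : metallic_structure p q J)
    (M : riemannian_manifold R m') (f : M -> Mbar)
    (immersed : isometric_immersion f) :
  semi_slant f J <->
  exists lambda : R,
    [/\ 0 <= lambda < 1,
        is_distribution (eigen_fields f J p q lambda) &
        forall X : M -> 'rV[R]_m', smooth_field X ->
          (forall Y : M -> 'rV[R]_m', eigen_fields f J p q lambda Y ->
             forall x, inner (metric x) (X x) (Y x) = 0) ->
          forall x, X x *m nor_part f J x = 0].
Proof.
split=> [/(semi_slant_eigen q_gt0 metallic immersed)|[lam [lam01 [D [dD DE]] nor0]]].
  move=> [lam [D1 [D2 [lam01 dD2 inD1 nor0 eigD2]]]]; exists lam.
  have DE : eigen_fields f J p q lam = sections D2.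
    by apply/seteqP; split=> X [sX XE]; split=> // x; apply/eigD2/XE.
  split=> //; first by exists D2.
  move=> X _ XY x; apply/nor0/inD1 => v vD2.
  have [Y Ys <-] := sections_at dD2 vD2.
  by apply: XY; rewrite DE.
apply: (eigen_semi_slant q_gt0 metallic immersed lam01 dD) => x u.
  by move=> /(sections_at dD)[X + <-]; rewrite -DE => -[_]; apply.
move=> uD1; have [X [sX XD1] <-] := sections_at (orth_distribution dD) uD1.
apply: nor0 => // Y; rewrite DE => -[_ YD] y.
exact: (orth_complP _ _ _ (XD1 y)).
Qed.
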